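(* For a non-ergodic $\mu$-symmetric continuous-time Markov chain on a countable state space $E$ with Dirichlet form $(D,\mathscr D(D))$ on $L^2(\mu)$, one has $\alpha^*=\lambda_0$, where $$\alpha^*=\sup\{\alpha:\ p_{ij}(t)=O(e^{-\alpha t})\text{ as }t\to\infty\text{ for all }i,j\in E\},\qquad \lambda_0=\inf\{D(f):\ f\in\mathscr D(D),\ \|f\|=1\}.$$
   Context: The chain has standard (sub-stochastic) transition probabilities $p_{ij}(t)$, $i,j\in E$, and $\mu=(\mu_i)_{i\in E}$ is a measure with $\mu_i>0$ for all $i$ and $\mu_ip_{ij}(t)=\mu_jp_{ji}(t)$ for all $i,j,t$. Non-ergodic means $\pi_j:=\lim_{t\to\infty}p_{ij}(t)=0$ for all $i,j\in E$ (the general definition of $\alpha^*$ uses $|p_{ij}(t)-\pi_j|$ in place of $p_{ij}(t)$). $P_tf(i)=\sum_jp_{ij}(t)f_j$ is the associated symmetric semigroup on $L^2(\mu)$, $\|\cdot\|$ is the $L^2(\mu)$-norm, $D(f)=\lim_{t\downarrow0}\frac1t(f-P_tf,f)$ and $\mathscr D(D)=\{f\in L^2(\mu): D(f)<\infty\}$ with $D(f)$ understood as this (increasing) limit. *)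

(* Defs.v *)
From mathcomp Require Import all_boot all_order all_algebra.
From mathcomp Require Import all_classical all_reals all_analysis.

Set Implicit Arguments.
Unset Strict Implicit.
Unset Printing Implicit Defensive.

Import Order.TTheory GRing.Theory Num.Theory.
Import numFieldNormedType.Exports.

Local Open Scope classical_set_scope.
Local Open Scope ring_scope.

(* Needed by the Landau notation =O_ +oo. *)
Canonical pinfty_nbhs_filter_on (R : realType) :=
  FilterType (pinfty_nbhs R) _.

Section Defs.
Context {R : realType} {E : countType}.

(* Sum over E of a real family.  The library's esum only has its intended
   meaning on nonnegative families, hence the positive and negative parts;
   this is the value of every absolutely convergent sum over E. *)
Definition csum (a : E -> R) : R :=
  fine (\esum_(i in [set: E]) (a^\+ i)%:E - \esum_(i in [set: E]) (a^\- i)%:E)%E.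

(* [p t i j] is p_{ij}(t); only times t >= 0 are constrained. *)
Record standard_transition (p : R -> E -> E -> R) : Prop := StandardTransition {
  transition_ge0 : forall (t : R) i j, 0 <= t -> 0 <= p t i j ;
  transition_le1 : forall (t : R) i, 0 <= t ->
    (\esum_(j in [set: E]) (p t i j)%:E <= 1)%E ;
  transition_id : forall i j, p 0 i j = (i == j)%:R ;
  chapman_kolmogorov : forall (s t : R) i k, 0 <= s -> 0 <= t ->
    (p (s + t) i k)%:E = \esum_(j in [set: E]) (p s i j * p t j k)%:E ;
  transition_standard : forall i j,
    p t i j @[t --> 0^'+] --> ((i == j)%:R : R) }.

Definition symmetric_wrt (mu : E -> R) (p : R -> E -> E -> R) : Prop :=
  forall (t : R) i j, 0 <= t -> mu i * p t i j = mu j * p t j i.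

Definition non_ergodic (p : R -> E -> E -> R) : Prop :=
  forall i j, p t i j @[t --> +oo] --> (0 : R).

Definition L2 (mu : E -> R) : set (E -> R) :=
  [set f | (\esum_(i in [set: E]) (mu i * f i ^+ 2)%:E < +oo)%E].

Definition inner (mu : E -> R) (f g : E -> R) : R :=
  csum (fun i => mu i * f i * g i).

Definition L2norm (mu : E -> R) (f : E -> R) : R := Num.sqrt (inner mu f f).

Definition semigroup (p : R -> E -> E -> R) (t : R) (f : E -> R) : E -> R :=
  fun i => csum (fun j => p t i j * f j).

(* The limit is taken in the extended reals, where it may be +oo. *)
Definition dirichlet (mu : E -> R) (p : R -> E -> E -> R) (f : E -> R) : \bar R :=
  lim ((t^-1 * inner mu (f \- semigroup p t f) f)%:E @[t --> 0^'+]).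

Definition dirichlet_domain (mu : E -> R) (p : R -> E -> E -> R) :
    set (E -> R) :=
  [set f | L2 mu f /\ (dirichlet mu p f < +oo)%E].

Definition alpha_star (p : R -> E -> E -> R) : \bar R :=
  ereal_sup [set a%:E | a in [set a : R | forall i j,
    (fun t => p t i j) =O_ +oo (fun t => expR (- a * t))]].

Definition lambda0 (mu : E -> R) (p : R -> E -> E -> R) : \bar R :=
  ereal_inf [set dirichlet mu p f | f in
    [set f | dirichlet_domain mu p f /\ L2norm mu f = 1]].

End Defs.

(* Main.v *)
(* For f in L^2(mu), symmetry and the semigroup property give
   (P_{s+t} f, f) = (P_s f, P_t f), so by Cauchy-Schwarz
   phi_f(t) = (P_t f, f) is log-convex; it is also bounded by ||f||^2.  Hence
   (phi_f(0) - phi_f(t)) / t increases to D(f) as t decreases to 0.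

   If l < lambda_0, apply D(g) > l ||g||^2 to g = P_{T/2} 1_i:
   p_ii(T+h) <= e^{-lh} p_ii(T) for all small h.  By log-convexity
   the ratio p_ii(t+h) / p_ii(t) increases with t, so the same bound holds for
   every earlier step of length h = T/n, whence p_ii(T) <= e^{-lT};
   Cauchy-Schwarz extends the rate to p_ij.

   Conversely, if p_ij(t) = O(e^{-at}) for all i, j, then phi_f(t) = O(e^{-at})
   for finitely supported f, and log-convexity forces the constant to be
   phi_f(0): phi_f(t) <= e^{-at} ||f||^2.  This passes to nonnegative f in L^2 by
   taking suprema over finite subsums, then to every f through |f|, and letting
   t tend to 0 gives D(f) >= a ||f||^2. *)
Require Import Defs.
From mathcomp Require Import all_boot all_order all_algebra finmap.
From mathcomp Require Import all_classical all_reals all_analysis.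
From mathcomp Require Import ring lra.
Set Implicit Arguments.
Unset Strict Implicit.
Unset Printing Implicit Defensive.

Import Order.TTheory GRing.Theory Num.Theory.
Import numFieldNormedType.Exports.
Local Open Scope classical_set_scope.
Local Open Scope ring_scope.

(** * Log-convex sequences and functions *)

Section LogConvexSequence.
Context {R : realType} (c : nat -> R).
Hypothesis c_ge0 : forall n, 0 <= c n.
Hypothesis c_logconvex : forall n, c n.+1 ^+ 2 <= c n * c n.+2.

(** Log-convexity makes the ratios [c k.+1 / c k] nondecreasing, so a bound [q] on the last ratio
    holds for every earlier one; the product of these ratios telescopes. Vanishing terms are treated
    apart to avoid division. *)
Lemma logconvex_le_backward (q : R) n : 0 <= q -> c n.+1 <= q * c n ->
  c n <= q ^+ n * c 0%N.
Proof.
move=> q0; elim: n => [|n IH] cn; first by rewrite expr0 mul1r.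
have cn1 : c n.+1 <= q * c n.
  have [c0|cne] := eqVneq (c n.+1) 0; first by rewrite c0 mulr_ge0.
  have cgt : 0 < c n.+1 by rewrite lt_def cne c_ge0.
  rewrite -(ler_pM2r cgt) -expr2 (le_trans (c_logconvex n))//.
  by rewrite mulrAC [leRHS]mulrC ler_wpM2l// mulrC.
by rewrite (le_trans cn1)// exprS -mulrA ler_wpM2l// IH.
Qed.

(** A lower bound on the first ratio persists for all later ones; positivity of [c k] is carried
    along in the induction so that it can be cancelled. *)
Lemma logconvex_ge_forward (r : R) n : 0 < r -> 0 < c 0%N -> r * c 0%N <= c 1%N ->
  r ^+ n * c 0%N <= c n.
Proof.
move=> r0 c0 c01.
have step k : 0 < c k /\ r * c k <= c k.+1.
  elim: k => [//|k [ck ckr]].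
  have ck1 : 0 < c k.+1 by rewrite (lt_le_trans _ ckr)// mulr_gt0.
  split=> //; rewrite -(ler_pM2l ck) (le_trans _ (c_logconvex k))//.
  by rewrite mulrCA mulrA expr2 ler_pM2r.
elim: n => [|n IH]; first by rewrite expr0 mul1r.
by rewrite (le_trans _ (step n).2)// exprS -mulrA ler_pM2l.
Qed.

(** If the first ratio exceeded [q], the sequence would grow at least like its powers, and no
    constant [C] could absorb the excess. The bound thus passes to the first step with [C] gone. *)
Lemma logconvex_geometric_bound (C q : R) N : 0 < q ->
  (forall n, (N <= n)%N -> c n <= C * q ^+ n) -> c 1%N <= q * c 0%N.
Proof.
move=> q0 cC; rewrite leNgt; apply/negP => c01.
have c0 : 0 < c 0%N.
  rewrite lt_def c_ge0 andbT; apply/eqP => c0.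
  have := c_logconvex 0%N; rewrite c0 mul0r => c1.
  have /eqP c10 : c 1%N == 0 by rewrite -sqrf_eq0 eq_le c1 sqr_ge0.
  by move: c01; rewrite c0 mulr0 c10 ltxx.
(* [r] is the excess of the first ratio over [q]; Bernoulli's inequality makes its powers
   unbounded. *)
set r := c 1%N / c 0%N / q.
have r1 : 1 < r by rewrite ltr_pdivlMr// mul1r ltr_pdivlMr.
have bernoulli n : 1 + n%:R * (r - 1) <= r ^+ n.
  elim: n => [|n IH]; first by rewrite mul0r addr0 expr0.
  rewrite exprS (@le_trans _ _ (r * (1 + n%:R * (r - 1))))//; last first.
    by rewrite ler_pM2l// (lt_trans ltr01).
  have n0 : 0 <= n%:R * (r - 1) ^+ 2 by rewrite mulr_ge0// sqr_ge0.
  by rewrite -natr1; lra.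
have bnd n : (N <= n)%N -> n%:R <= C / c 0%N / (r - 1).
  move=> Nn; rewrite ler_pdivlMr ?subr_gt0//.
  rewrite (@le_trans _ _ (r ^+ n))//; first by rewrite (le_trans _ (bernoulli n))// lerDr.
  rewrite expr_div_n ler_pdivrMr ?exprn_gt0// mulrAC ler_pdivlMr//.
  rewrite (le_trans _ (cC _ Nn))// logconvex_ge_forward// ?divr_gt0//.
    by rewrite (lt_trans _ c01)// mulr_gt0.
  by rewrite divfK// gt_eqF.
set B := C / c 0%N / (r - 1) in bnd.
(* An index past both [N] and [B] contradicts [bnd]. *)
have := bnd (N + (Num.truncn B).+1)%N (leq_addr _ _).
by rewrite leNgt natrD (lt_le_trans (truncnS_gt B))// lerDr.
Qed.

(** Log-convexity gives convexity through the inequality of arithmetic and geometric means, used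
    here in squared form. *)
Lemma logconvex_midpoint n : c n.+1 *+ 2 <= c n + c n.+2.
Proof.
have c02 : 0 <= c n + c n.+2 by rewrite addr_ge0.
rewrite -(ler_pXn2r (ltn0Sn 1)) ?nnegrE ?mulrn_wge0//.
have := c_logconvex n; have := sqr_ge0 (c n - c n.+2); rewrite mulr2n; nra.
Qed.

Lemma logconvex_slope m n : (m <= n)%N ->
  (c 0%N - c n) * m%:R <= (c 0%N - c m) * n%:R.
Proof.
(* By convexity the decrements decrease, so the next one is at most the average of the first [k]. *)
have step k : k%:R * (c k - c k.+1) <= c 0%N - c k.
  elim: k => [|k IH]; first by rewrite mul0r subrr.
  have := logconvex_midpoint k; rewrite mulr2n -natr1 => ck.
  have k0 : 0 <= k%:R :> R by [].
  nra.
elim: n => [|n IH]; first by rewrite leqn0 => /eqP ->.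
rewrite leq_eqVlt => /predU1P[->//|]; rewrite ltnS => mn.
have [n0|n0] := posnP n.
  by move: mn; rewrite n0 leqn0 => /eqP ->; rewrite mulr0 subrr mul0r.
have n0' : 0 < n%:R :> R by rewrite ltr0n.
rewrite -(ler_pM2l n0').
have m0 : 0 <= m%:R :> R by [].
have := step n; have := IH mn; rewrite -natr1; nra.
Qed.

End LogConvexSequence.

(** * Log-convex functions on the half-line, studied along arithmetic grids *)

Section LogConvexFunction.
Context {R : realType} (phi : R -> R).
Hypothesis phi_ge0 : forall t : R, 0 <= t -> 0 <= phi t.
Hypothesis phi_logconvex : forall s t : R, 0 <= s -> 0 <= t ->
  phi (s + t) ^+ 2 <= phi (s + s) * phi (t + t).

Let grid_ge0 (s h : R) n : 0 <= s -> 0 <= h -> 0 <= phi (s + n%:R * h).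
Proof. by move=> s0 h0; rewrite phi_ge0// addr_ge0// mulr_ge0. Qed.

(** [phi_logconvex] has the shape that Cauchy-Schwarz produces for a semigroup. Applying it at half
    of two grid points whose indices differ by two puts their midpoint on the left. *)
Let grid_logconvex (s h : R) n : 0 <= s -> 0 <= h ->
  phi (s + n.+1%:R * h) ^+ 2 <= phi (s + n%:R * h) * phi (s + n.+2%:R * h).
Proof.
move=> s0 h0; have nh k : 0 <= (s + k%:R * h) / 2.
  by rewrite divr_ge0// addr_ge0// mulr_ge0.
have := phi_logconvex (nh n) (nh n.+2); congr (phi _ ^+ 2 <= phi _ * phi _);
  by rewrite -?(natr1 n.+1) -?(natr1 n); field.
Qed.

(** On the grid starting at [s] with mesh [t - s], boundedness is a geometric bound with ratio 1, so
    the first step cannot increase. *)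
Lemma logconvex_bounded_nonincreasing (M : R) : (forall t : R, 0 <= t -> phi t <= M) ->
  forall s t : R, 0 <= s -> s <= t -> phi t <= phi s.
Proof.
move=> phiM s t s0 st; have h0 : 0 <= t - s by rewrite subr_ge0.
have := @logconvex_geometric_bound R _ (fun n => grid_ge0 n s0 h0)
  (fun n => grid_logconvex n s0 h0) M 1 0%N ltr01.
rewrite !mul1r mul0r addr0 subrKC; apply => n _.
by rewrite expr1n mulr1 phiM// addr_ge0// mulr_ge0.
Qed.

(** Continuity of [phi] is not assumed: [s / t] is approximated from below by a rational [m / n],
    the slope inequality is used on the grid of mesh [t / n], and monotonicity replaces the grid
    point by [s]. *)
Lemma logconvex_bounded_slope (M : R) : (forall t : R, 0 <= t -> phi t <= M) ->
  forall s t : R, 0 < s -> s <= t ->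
  (phi 0 - phi t) / t <= (phi 0 - phi s) / s.
Proof.
move=> phiM s t s0 st; have t0 := lt_le_trans s0 st.
have phi_le := logconvex_bounded_nonincreasing phiM.
have St0 : 0 <= phi 0 - phi t by rewrite subr_ge0 phi_le// ltW.
rewrite ler_pdivrMr// mulrAC ler_pdivlMr//.
apply/ler_addgt0Pr => e e0 /=.
(* The mesh is so fine that the rounding error, at most [t * (phi 0 - phi t) / n], stays below
   [e]. *)
pose n := (Num.truncn (t * (phi 0 - phi t) / e)).+1.
have n0 : 0 < n%:R :> R by rewrite ltr0n.
(* [m * (t / n)] is the last grid point not beyond [s]. *)
pose m := Num.truncn (s * n%:R / t).
have sn0 : 0 <= s * n%:R / t by rewrite !mulr_ge0 ?invr_ge0// ltW.
have /andP[ms sm] := truncn_itv sn0.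
rewrite -/m in ms sm.
have mn : (m <= n)%N.
  by rewrite -(ler_nat R) (le_trans ms)// ler_pdivrMr// mulrC ler_pM2l.
have h0 : 0 <= t / n%:R by rewrite divr_ge0// ltW.
have := @logconvex_slope R _ (fun n => grid_ge0 n (lexx 0) h0)
  (fun n => grid_logconvex n (lexx 0) h0) m n mn.
rewrite !add0r mul0r (mulrC n%:R (t / n%:R)) divfK ?gt_eqF// => Sm.
have Ss : phi 0 - phi (m%:R * (t / n%:R)) <= phi 0 - phi s.
  rewrite lerD2l lerN2 phi_le ?(mulr_ge0 (ler0n _ _))//.
  by rewrite mulrA ler_pdivrMr// -ler_pdivlMr.
have en : t * (phi 0 - phi t) <= e * n%:R.
  by rewrite [leRHS]mulrC -ler_pdivrMr// ltW// truncnS_gt.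
move: sm; rewrite -natr1 ltr_pdivrMr// => sm.
rewrite -(ler_pM2r n0).
move: Ss Sm sm en St0; set St := phi 0 - phi t; set S1 := phi 0 - phi s.
set Sm := phi 0 - phi _; move=> Ss Sm' sm en St0.
have : St * m%:R * t <= S1 * n%:R * t.
  by rewrite ler_pM2r// (le_trans Sm')// ler_pM2r.
have : St * (s * n%:R) <= St * ((m%:R + 1) * t) by rewrite ler_wpM2l// ltW.
nra.
Qed.

Lemma logconvex_decay_backward (l T : R) : 0 < T ->
  (\forall h \near 0^'+, phi (T + h) <= expR (- l * h) * phi T) ->
  phi T <= expR (- l * T) * phi 0.
Proof.
move=> T0 [e /= e0 He].
(* [T] is the [n]-th grid point, and [h < e] puts the step after [T] within reach of the
   hypothesis. *)
pose n := (Num.truncn (T / e)).+1; pose h := T / n%:R.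
have n0 : 0 < n%:R :> R by rewrite ltr0n.
have h0 : 0 < h by rewrite divr_gt0.
have nh : n%:R * h = T by rewrite mulrC divfK// gt_eqF.
have eT : expR (- l * h) ^+ n = expR (- l * T) by rewrite -expRM_natl mulrCA nh.
have := @logconvex_le_backward R _ (fun n => grid_ge0 n (lexx 0) (ltW h0))
  (fun n => grid_logconvex n (lexx 0) (ltW h0)) (expR (- l * h)) n.
rewrite eT !add0r mul0r nh; apply; first exact: expR_ge0.
rewrite -natr1 mulrDl mul1r nh; apply: He => //.
rewrite /ball/= sub0r normrN gtr0_norm// ltr_pdivrMr// mulrC -ltr_pdivrMr//.
exact: truncnS_gt.
Qed.

Lemma logconvex_decay_forward (C a h : R) : 0 <= h ->
  (\forall t \near +oo, phi t <= C * expR (- a * t)) ->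
  phi h <= expR (- a * h) * phi 0.
Proof.
rewrite le_eqVlt => /predU1P[<- _|h0]; first by rewrite mulr0 expR0 mul1r.
move=> [B [_ HB]].
(* On the grid of mesh [h] the decay is geometric with ratio [expR (- a * h)] as soon as [n * h]
   exceeds [B]; the first step then inherits the ratio without [C]. *)
have := @logconvex_geometric_bound R _ (fun n => grid_ge0 n (lexx 0) (ltW h0))
  (fun n => grid_logconvex n (lexx 0) (ltW h0)) C (expR (- a * h))
  (Num.truncn (B / h)).+1 (expR_gt0 _).
rewrite mul0r !add0r mul1r; apply => n Bn.
rewrite -expRM_natl -mulrCA add0r; apply: HB.
rewrite -ltr_pdivrMr// (lt_le_trans (truncnS_gt _))// ler_nat//.
Qed.
End LogConvexFunction.

(** * Sums over a countable type *)

Section ExtendedSum.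
Context {R : realType} {E : choiceType}.

Lemma ge0_esumZl (c : R) (a : E -> \bar R) : 0 <= c -> (forall i, 0 <= a i)%E ->
  (\esum_(i in [set: E]) (c%:E * a i) = c%:E * \esum_(i in [set: E]) a i)%E.
Proof.
rewrite le_eqVlt => /predU1P[<- _|c0 a0].
  by rewrite mul0e esum1// => i _; rewrite mul0e.
have le_esumZ (k : R) (b : E -> \bar R) : 0 < k -> (forall i, 0 <= b i)%E ->
    (\esum_(i in [set: E]) (k%:E * b i) <= k%:E * \esum_(i in [set: E]) b i)%E.
  move=> k0 b0; apply: ge_ereal_sup => _ [X [finX XT] <-].
  rewrite -ge0_mule_fsumr// lee_pmul2l ?lte_fin//.
  by apply: ereal_sup_ubound; exists X.
(* The reverse inequality is [le_esumZ] for the factor [c^-1] and the family [c * a]. *)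
apply/eqP; rewrite eq_le le_esumZ//=.
rewrite -(@lee_pmul2l _ c^-1%:E) ?lte_fin ?invr_gt0//.
rewrite muleA -EFinM mulVf ?gt_eqF// mul1e.
apply: le_trans (le_esumZ c^-1 _ _ _); rewrite ?invr_gt0//; last first.
  by move=> i; rewrite mule_ge0// lee_fin ltW.
by apply: le_esum => i _; rewrite muleA -EFinM mulVf ?gt_eqF// mul1e.
Qed.

(** Tonelli: both iterated sums are sums over pairs, matched by swapping coordinates. *)
Lemma esum_exchange (a : E -> E -> \bar R) : (forall i j, 0 <= a i j)%E ->
  (\esum_(i in [set: E]) \esum_(j in [set: E]) a i j =
   \esum_(j in [set: E]) \esum_(i in [set: E]) a i j)%E.
Proof.
move=> a0; rewrite !esum_esum//.
rewrite (reindex_esum ([set: E] `*`` fun=> [set: E])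
  ([set: E] `*`` fun=> [set: E]) (fun k => (k.2, k.1)))//.
by split=> [? ?|[? ?] [? ?] _ _ [-> ->]//|[x y] _]; [|exists (y, x)].
Qed.

End ExtendedSum.

(** * Linearity and monotonicity of [csum] on absolutely convergent families *)

Section AbsolutelySummable.
Context {R : realType} {E : countType}.
Implicit Types (a b u v : E -> R) (c : R).

Definition abs_summable a := (\esum_(i in [set: E]) `|a i|%:E < +oo)%E.

Let esumR a : \bar R := (\esum_(i in [set: E]) (a i)%:E)%E.
Arguments esumR a%_R.

Let esumR_ge0 u : (forall i, 0 <= u i) -> (0 <= esumR u)%E.
Proof. by move=> u0; apply: esum_ge0 => i _; rewrite lee_fin. Qed.

Let esumR_fin u : (forall i, 0 <= u i) -> (esumR u < +oo)%E ->
  esumR u \is a fin_num.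
Proof. by move=> u0 uoo; rewrite ge0_fin_numE// esumR_ge0. Qed.

Lemma le_abs_summable u a : (forall i, `|a i| <= u i) ->
  (\esum_(i in [set: E]) (u i)%:E < +oo)%E -> abs_summable a.
Proof.
by move=> au; apply: le_lt_trans; apply: le_esum => i _; rewrite lee_fin.
Qed.

Lemma csum_ge0E u : (forall i, 0 <= u i) ->
  csum u = fine (\esum_(i in [set: E]) (u i)%:E).
Proof.
move=> u0; rewrite /csum [X in (_ - X)%E]esum1 ?sube0.
  by congr fine; apply: eq_esum => i _; rewrite /funrpos max_l.
by move=> i _; rewrite /funrneg max_r// oppr_le0.
Qed.

(** The value of [csum] does not depend on how a family is split into nonnegative ones; linearity
    rests on this. With [a = u - v], the identity [a^+ + v = u + a^-] involves only nonnegative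
    families with finite sums. *)
Lemma csumB_ge0 u v : (forall i, 0 <= u i) -> (forall i, 0 <= v i) ->
  (esumR u < +oo)%E -> (esumR v < +oo)%E ->
  csum (fun i => u i - v i) = csum u - csum v.
Proof.
move=> u0 v0 uoo voo; rewrite (csum_ge0E u0) (csum_ge0E v0) /csum.
set a := fun i => u i - v i.
have poo : (esumR (funrpos a) < +oo)%E.
  apply: le_lt_trans uoo; apply: le_esum => i _; rewrite lee_fin /funrpos /a.
  by rewrite ge_max u0 lerBlDr lerDl v0.
have noo : (esumR (funrneg a) < +oo)%E.
  apply: le_lt_trans voo; apply: le_esum => i _; rewrite lee_fin /funrneg /a.
  by rewrite ge_max v0 opprB lerBlDr lerDl u0.
have p0 i : 0 <= a^\+ i by [].
have n0 i : 0 <= a^\- i by [].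
have : (esumR (funrpos a) + esumR v = esumR u + esumR (funrneg a))%E.
  rewrite -!esumD//; do ?by move=> i _; rewrite lee_fin.
  apply: eq_esum => i _; rewrite -!EFinD /funrpos /funrneg /a; congr _%:E.
  by case: (leP (u i - v i) 0) => uv; [rewrite max_l ?max_r|rewrite max_r ?max_l]; lra.
have := esumR_fin p0 poo; have := esumR_fin n0 noo.
have := esumR_fin u0 uoo; have := esumR_fin v0 voo.
rewrite -/(esumR (funrpos a)) -/(esumR (funrneg a)) -/(esumR u) -/(esumR v).
move=> /fineK <- /fineK <- /fineK <- /fineK <-.
by move=> [] /=; lra.
Qed.

Let pos_neg a i : a i = a^\+ i - a^\- i.
Proof. by rewrite /funrpos /funrneg; case: (leP (a i) 0); case: (leP (- a i) 0); lra. Qed.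

Let funrpos_summable a : abs_summable a -> (esumR (funrpos a) < +oo)%E.
Proof.
apply: le_lt_trans; apply: le_esum => i _; rewrite lee_fin /funrpos ge_max.
by rewrite normr_ge0 ler_norm.
Qed.

Let funrneg_summable a : abs_summable a -> (esumR (funrneg a) < +oo)%E.
Proof.
apply: le_lt_trans; apply: le_esum => i _; rewrite lee_fin /funrneg ge_max.
by rewrite normr_ge0 -normrN ler_norm.
Qed.

Let csum_split a : abs_summable a -> csum a = csum a^\+ - csum a^\-.
Proof.
move=> sa; rewrite -(csumB_ge0 (funrpos_ge0 a) (funrneg_ge0 a)
  (funrpos_summable sa) (funrneg_summable sa)).
by congr csum; apply/funext => i; exact: pos_neg.
Qed.

Let esumRD u v : (forall i, 0 <= u i) -> (forall i, 0 <= v i) ->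
  esumR (u \+ v) = (esumR u + esumR v)%E.
Proof. by move=> u0 v0; rewrite -esumD// => i _; rewrite lee_fin. Qed.

Let csumD_ge0 u v : (forall i, 0 <= u i) -> (forall i, 0 <= v i) ->
  (esumR u < +oo)%E -> (esumR v < +oo)%E -> csum (u \+ v) = csum u + csum v.
Proof.
move=> u0 v0 uoo voo; rewrite !csum_ge0E//; last by move=> i /=; rewrite addr_ge0.
by rewrite -/(esumR _) esumRD// fineD// esumR_fin.
Qed.

Lemma csumD a b : abs_summable a -> abs_summable b ->
  csum (fun i => a i + b i) = csum a + csum b.
Proof.
move=> sa sb.
have -> : (fun i => a i + b i) =
    (fun i => (a^\+ \+ b^\+) i - (a^\- \+ b^\-) i).
  by apply/funext => i; rewrite /= (pos_neg a) (pos_neg b); ring.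
have aD u v i : 0 <= u i -> 0 <= v i -> 0 <= (u \+ v) i by exact: addr_ge0.
have pD : (esumR (funrpos a \+ funrpos b)%R < +oo)%E.
  by rewrite esumRD// lte_add_pinfty// funrpos_summable.
have nD : (esumR (funrneg a \+ funrneg b)%R < +oo)%E.
  by rewrite esumRD// lte_add_pinfty// funrneg_summable.
rewrite csumB_ge0//; try by move=> i; apply: aD.
rewrite !csumD_ge0//; try exact: funrpos_summable; try exact: funrneg_summable.
by rewrite (csum_split sa) (csum_split sb); ring.
Qed.

Lemma csumZ c a : abs_summable a -> csum (fun i => c * a i) = c * csum a.
Proof.
have csumZ_ge0 (k : R) u : 0 <= k -> (forall i, 0 <= u i) -> (esumR u < +oo)%E ->
    csum (fun i => k * u i) = k * csum u /\ (esumR (fun i => k * u i)%R < +oo)%E.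
  move=> k0 u0 uoo; have e : esumR (fun i => k * u i) = (k%:E * esumR u)%E.
    by rewrite -ge0_esumZl.
  split; last by rewrite e lte_mul_pinfty.
  rewrite !csum_ge0E//; last by move=> i; rewrite mulr_ge0.
  by rewrite -/(esumR _) e fineM// esumR_fin.
move=> sa; have poo := funrpos_summable sa; have noo := funrneg_summable sa.
rewrite (csum_split sa); have [c0|/ltW c0] := leP 0 c.
  have [p1 p2] := csumZ_ge0 _ _ c0 (funrpos_ge0 a) poo.
  have [n1 n2] := csumZ_ge0 _ _ c0 (funrneg_ge0 a) noo.
  rewrite mulrBr -p1 -n1 -csumB_ge0//; try by move=> i; rewrite mulr_ge0.
  by congr csum; apply/funext => i; rewrite [in LHS](pos_neg a) mulrBr.
have c0' : 0 <= - c by rewrite oppr_ge0.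
have [p1 p2] := csumZ_ge0 _ _ c0' (funrpos_ge0 a) poo.
have [n1 n2] := csumZ_ge0 _ _ c0' (funrneg_ge0 a) noo.
(* A negative factor exchanges the roles of the positive and negative parts. *)
have -> : c * (csum a^\+ - csum a^\-) = - c * csum a^\- - - c * csum a^\+ by ring.
rewrite -p1 -n1 -csumB_ge0//; try by move=> i; rewrite mulr_ge0.
by congr csum; apply/funext => i; rewrite [in LHS](pos_neg a); ring.
Qed.

Lemma abs_summableZ c a : abs_summable a -> abs_summable (fun i => c * a i).
Proof.
move=> a1; rewrite /abs_summable; under eq_esum do rewrite normrM EFinM.
by rewrite ge0_esumZl// lte_mul_pinfty// lee_fin.
Qed.

Lemma abs_summableD a b : abs_summable a -> abs_summable b ->
  abs_summable (fun i => a i + b i).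
Proof.
move=> a1 b1; apply: (@le_abs_summable (fun i => `|a i| + `|b i|)).
  by move=> i; exact: ler_normD.
under eq_esum do rewrite EFinD.
by rewrite esumD ?lte_add_pinfty// => i _; rewrite lee_fin.
Qed.

Lemma csum_ge0 u : (forall i, 0 <= u i) -> 0 <= csum u.
Proof. by move=> u0; rewrite csum_ge0E// fine_ge0// esumR_ge0. Qed.

Lemma le_csum a b : abs_summable a -> abs_summable b ->
  (forall i, a i <= b i) -> csum a <= csum b.
Proof.
move=> a1 b1 ab; rewrite -subr_ge0 -mulN1r -csumZ// -csumD//; last first.
  exact: abs_summableZ.
by apply: csum_ge0 => i; rewrite mulN1r subr_ge0.
Qed.

End AbsolutelySummable.

(** * The space L^2(mu) *)

Section WeightedL2.
Context {R : realType} {E : countType} (mu : E -> R).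
Hypothesis mu_gt0 : forall i, 0 < mu i.
Implicit Types (f g h : E -> R) (c : R).

Let mu_ge0 i : 0 <= mu i. Proof. exact: ltW. Qed.

Lemma L2_le f g : (forall i, `|f i| <= `|g i|) -> L2 mu g -> L2 mu f.
Proof.
move=> fg; apply: le_lt_trans; apply: le_esum => i _; rewrite lee_fin.
by rewrite ler_pM2l// -[f i ^+ 2]real_normK ?num_real//
  -[g i ^+ 2]real_normK ?num_real// lerXn2r ?nnegrE.
Qed.

Lemma L2Z c f : L2 mu f -> L2 mu (fun i => c * f i).
Proof.
move=> f2; rewrite /L2/=.
under eq_esum do rewrite exprMn mulrCA EFinM.
rewrite ge0_esumZl ?sqr_ge0//; last first.
  by move=> i; rewrite lee_fin mulr_ge0// sqr_ge0.
by rewrite lte_mul_pinfty// lee_fin sqr_ge0.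
Qed.

Lemma L2D f g : L2 mu f -> L2 mu g -> L2 mu (fun i => f i + g i).
Proof.
(* The crude bound [(f + g)^2 <= (2f)^2 + (2g)^2] suffices for finiteness. *)
move=> /(L2Z 2) f2 /(L2Z 2) g2; apply: (@le_lt_trans _ _
  (\esum_(i in [set: E]) ((mu i * (2 * f i) ^+ 2)%:E + (mu i * (2 * g i) ^+ 2)%:E)%E)).
  apply: le_esum => i _; rewrite -EFinD lee_fin -mulrDr ler_pM2l//.
  by have := sqr_ge0 (f i - g i); have := sqr_ge0 (f i); have := sqr_ge0 (g i); nra.
by rewrite esumD ?lte_add_pinfty// => i _; rewrite lee_fin mulr_ge0// sqr_ge0.
Qed.

Lemma inner_summable f g : L2 mu f -> L2 mu g ->
  abs_summable (fun i => mu i * f i * g i).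
Proof.
move=> f2 g2; apply: (@le_abs_summable _ _
    (fun i => mu i * f i ^+ 2 + mu i * g i ^+ 2)) => [i|].
  rewrite -mulrA normrM (gtr0_norm (mu_gt0 i)) -mulrDr ler_pM2l// ler_norml.
  have := sqr_ge0 (f i - g i); have := sqr_ge0 (f i + g i).
  have := sqr_ge0 (f i); have := sqr_ge0 (g i).
  by move=> ? ? ? ?; apply/andP; split; nra.
under eq_esum do rewrite EFinD.
by rewrite esumD ?lte_add_pinfty// => i _; rewrite lee_fin mulr_ge0// sqr_ge0.
Qed.

Lemma innerC f g : inner mu f g = inner mu g f.
Proof. by congr csum; apply/funext => i; rewrite mulrAC. Qed.

Lemma innerDl f g h : L2 mu f -> L2 mu g -> L2 mu h ->
  inner mu (fun i => f i + g i) h = inner mu f h + inner mu g h.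
Proof.
move=> f2 g2 h2; rewrite /inner -csumD; try exact: inner_summable.
by congr csum; apply/funext => i; rewrite mulrDr mulrDl.
Qed.

Lemma innerZl c f g : L2 mu f -> L2 mu g ->
  inner mu (fun i => c * f i) g = c * inner mu f g.
Proof.
move=> f2 g2; rewrite /inner -csumZ; last exact: inner_summable.
by congr csum; apply/funext => i; rewrite mulrCA !mulrA.
Qed.

Lemma innerDr f g h : L2 mu f -> L2 mu g -> L2 mu h ->
  inner mu h (fun i => f i + g i) = inner mu h f + inner mu h g.
Proof. by move=> *; rewrite innerC innerDl// !(innerC h). Qed.

Lemma innerZr c f g : L2 mu f -> L2 mu g ->
  inner mu f (fun i => c * g i) = c * inner mu f g.
Proof. by move=> *; rewrite innerC innerZl// innerC. Qed.

(** For nonnegative functions the inner product becomes an extended sum, to which Tonelli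
    applies. *)
Lemma inner_esum f g : (forall i, 0 <= f i) -> (forall i, 0 <= g i) ->
  L2 mu f -> L2 mu g ->
  (inner mu f g)%:E = (\esum_(i in [set: E]) (mu i * f i * g i)%:E)%E.
Proof.
move=> f0 g0 f2 g2; have fg0 i : 0 <= mu i * f i * g i by rewrite !mulr_ge0.
rewrite /inner csum_ge0E// fineK// ge0_fin_numE; last first.
  by apply: esum_ge0 => i _; rewrite lee_fin.
apply: le_lt_trans (inner_summable f2 g2); apply: le_esum => i _.
by rewrite lee_fin ler_norm.
Qed.

Lemma inner_normE f : inner mu f f = fine (\esum_(i in [set: E]) (mu i * f i ^+ 2)%:E).
Proof.
rewrite /inner csum_ge0E => [|i]; last by rewrite -mulrA -expr2 mulr_ge0// sqr_ge0.
by congr fine; apply: eq_esum => i _; rewrite -mulrA -expr2.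
Qed.

Lemma inner_ge0 f : 0 <= inner mu f f.
Proof.
by rewrite inner_normE fine_ge0// esum_ge0// => i _; rewrite lee_fin mulr_ge0// sqr_ge0.
Qed.

Lemma inner_le f g : (forall i, `|f i| <= `|g i|) -> L2 mu g ->
  inner mu f f <= inner mu g g.
Proof.
move=> fg g2; have f2 := L2_le fg g2.
have fin h : L2 mu h -> \esum_(i in [set: E]) (mu i * h i ^+ 2)%:E \is a fin_num.
  by rewrite ge0_fin_numE// esum_ge0// => i _; rewrite lee_fin mulr_ge0// sqr_ge0.
rewrite !inner_normE fine_le ?fin//.
apply: le_esum => i _; rewrite lee_fin ler_pM2l//.
by rewrite -[f i ^+ 2]real_normK ?num_real//
  -[g i ^+ 2]real_normK ?num_real// lerXn2r ?nnegrE.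
Qed.

Lemma inner_CauchySchwarz f g : L2 mu f -> L2 mu g ->
  inner mu f g ^+ 2 <= inner mu f f * inner mu g g.
Proof.
move=> f2 g2.
(* The squared norm of [f + x g] as a quadratic polynomial in [x]. *)
have quad x : 0 <= inner mu f f + 2 * x * inner mu f g + x ^+ 2 * inner mu g g.
  have xg2 := L2Z x g2; have := inner_ge0 (fun i => f i + x * g i).
  rewrite innerDl ?innerDr ?innerZl ?innerZr//; try exact: L2D.
  by rewrite (innerC g f); congr (0 <= _); ring.
have A0 := inner_ge0 f; have := inner_ge0 g.
move: quad A0; set A := inner mu f f; set B := inner mu f g; set C := inner mu g g.
move=> quad A0; rewrite le_eqVlt => /predU1P[C0|C0].
  rewrite -C0 mulr0; have [->|B0] := eqVneq B 0; first by rewrite expr0n.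
  (* When [g] has norm zero the polynomial is affine; if [B] were nonzero, this [x] would give it
     the value -1. *)
  have := quad (- (A + 1) / (2 * B)); rewrite -C0 mulr0 addr0.
  have -> : A + 2 * (- (A + 1) / (2 * B)) * B = - 1 by field.
  by rewrite lerNr oppr0 ler10.
(* The minimiser of the quadratic. *)
have := quad (- B / C); rewrite -(ler_pM2r C0) mul0r.
have -> : (A + 2 * (- B / C) * B + (- B / C) ^+ 2 * C) * C = A * C - B ^+ 2.
  by field; rewrite gt_eqF.
by rewrite subr_ge0.
Qed.

End WeightedL2.

(** * The symmetric semigroup *)

Section SymmetricSemigroup.
Context {R : realType} {E : countType} (p : R -> E -> E -> R) (mu : E -> R).
Hypothesis p_standard : standard_transition p.
Hypothesis mu_gt0 : forall i, 0 < mu i.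
Hypothesis p_symmetric : symmetric_wrt mu p.
Implicit Types (f g u v : E -> R) (s t : R).

Let mu_ge0 i : 0 <= mu i. Proof. exact: ltW. Qed.
Let p_ge0 t i j : 0 <= t -> 0 <= p t i j.
Proof. exact: transition_ge0. Qed.

Lemma transition_prob_le1 t i j : 0 <= t -> p t i j <= 1.
Proof.
move=> t0; rewrite -lee_fin (le_trans _ (transition_le1 p_standard i t0))//.
apply: esum_ge; exists [set j]; first by split.
by rewrite fsbig_set1.
Qed.

(** Symmetry gives [p t i j = mu j * p t j i / mu i <= mu j / mu i], so each row of the transition
    matrix is dominated by a multiple of [mu]. This makes [P_t f] well defined pointwise on L^2. *)
Let weighted_square t f i : 0 <= t ->
  (\esum_(j in [set: E]) (p t i j * f j ^+ 2)%:E <=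
   (mu i)^-1%:E * \esum_(j in [set: E]) (mu j * f j ^+ 2)%:E)%E.
Proof.
move=> t0; rewrite -ge0_esumZl ?invr_ge0//; last first.
  by move=> j; rewrite lee_fin mulr_ge0// sqr_ge0.
apply: le_esum => j _; rewrite -EFinM lee_fin [leRHS]mulrA ler_wpM2r ?sqr_ge0//.
rewrite -(ler_pM2l (mu_gt0 i)) mulrA mulfV ?gt_eqF// mul1r p_symmetric//.
by rewrite ger_pMr// transition_prob_le1.
Qed.

Lemma weighted_square_summable t f i : 0 <= t -> L2 mu f ->
  (\esum_(j in [set: E]) (p t i j * f j ^+ 2)%:E < +oo)%E.
Proof.
move=> t0 f2; apply: le_lt_trans (weighted_square _ _ t0) _.
by rewrite lte_mul_pinfty// lee_fin invr_ge0.
Qed.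

Lemma transition_summable t i : 0 <= t -> abs_summable (p t i).
Proof.
move=> t0; apply: (@le_lt_trans _ _ 1%E); last exact: ltry.
apply: le_trans (transition_le1 p_standard i t0).
by apply: le_esum => j _; rewrite ger0_norm// p_ge0.
Qed.

Lemma semigroup_summable t f i : 0 <= t -> L2 mu f ->
  abs_summable (fun j => p t i j * f j).
Proof.
(* From [|x| <= 1 + x^2], with row sums at most 1. *)
move=> t0 f2; apply: (@le_abs_summable _ _
    (fun j => `|p t i j| + p t i j * f j ^+ 2)) => [j|].
  rewrite normrM ger0_norm ?p_ge0// -[X in X + _]mulr1 -mulrDr ler_wpM2l ?p_ge0//.
  rewrite -[f j ^+ 2]real_normK ?num_real//.
  have := sqr_ge0 (`|f j| - 1); have := normr_ge0 (f j); nra.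
under eq_esum do rewrite EFinD.
rewrite esumD//; last by move=> j _; rewrite lee_fin mulr_ge0 ?p_ge0 ?sqr_ge0.
by apply: lte_add_pinfty; [exact: transition_summable|exact: weighted_square_summable].
Qed.

Lemma semigroupD t f g : 0 <= t -> L2 mu f -> L2 mu g ->
  semigroup p t (fun i => f i + g i) =
  (fun i => semigroup p t f i + semigroup p t g i).
Proof.
move=> t0 f2 g2; apply/funext => i; rewrite /semigroup -csumD;
  try exact: semigroup_summable.
by congr csum; apply/funext => j; rewrite mulrDr.
Qed.

Lemma semigroupZ t c f : 0 <= t -> L2 mu f ->
  semigroup p t (fun i => c * f i) = (fun i => c * semigroup p t f i).
Proof.
move=> t0 f2; apply/funext => i; rewrite /semigroup -csumZ;
  try exact: semigroup_summable.
by congr csum; apply/funext => j; rewrite mulrCA.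
Qed.

Lemma semigroup_ge0 t u i : 0 <= t -> (forall j, 0 <= u j) ->
  0 <= semigroup p t u i.
Proof.
by move=> t0 u0; apply: csum_ge0 => j; rewrite mulr_ge0 ?p_ge0.
Qed.

Lemma semigroup_ge0E t u i : 0 <= t -> (forall j, 0 <= u j) -> L2 mu u ->
  (semigroup p t u i)%:E = (\esum_(j in [set: E]) (p t i j * u j)%:E)%E.
Proof.
move=> t0 u0 u2; rewrite /semigroup csum_ge0E; last first.
  by move=> j; rewrite mulr_ge0 ?p_ge0.
rewrite fineK// ge0_fin_numE; last first.
  by apply: esum_ge0 => j _; rewrite lee_fin mulr_ge0 ?p_ge0.
apply: le_lt_trans (semigroup_summable i t0 u2); apply: le_esum => j _.
by rewrite lee_fin ler_norm.
Qed.

(* Expanding [0 <= \sum_j p_ij (f_j - m)^2] at [m = P_t f(i)] and using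
   [\sum_j p_ij <= 1]. *)
Lemma semigroup_Jensen t f i : 0 <= t -> L2 mu f ->
  ((semigroup p t f i ^+ 2)%:E <=
   \esum_(j in [set: E]) (p t i j * f j ^+ 2)%:E)%E.
Proof.
move=> t0 f2; have sq0 j : 0 <= p t i j * f j ^+ 2.
  by rewrite mulr_ge0 ?p_ge0 ?sqr_ge0.
have sq_fin := weighted_square_summable i t0 f2.
have sq_abs : abs_summable (fun j => p t i j * f j ^+ 2).
  by apply: le_abs_summable sq_fin => j; rewrite ger0_norm.
have f_abs := semigroup_summable i t0 f2.
have p_abs := transition_summable i t0.
rewrite -[leRHS]fineK; last by rewrite ge0_fin_numE// esum_ge0// => j _; rewrite lee_fin.
rewrite -csum_ge0E// lee_fin.
set m := semigroup p t f i.
have p1 : csum (p t i) <= 1.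
  rewrite csum_ge0E; last by move=> j; exact: p_ge0.
  rewrite -lee_fin fineK ?transition_le1//.
  rewrite ge0_fin_numE; last by apply: esum_ge0 => j _; rewrite lee_fin p_ge0.
  by apply: le_lt_trans (transition_le1 p_standard i t0) _; exact: ltry.
have : 0 <= csum (fun j => p t i j * f j ^+ 2 +
    (- (2 * m) * (p t i j * f j) + m ^+ 2 * p t i j)).
  have e j : p t i j * f j ^+ 2 + (- (2 * m) * (p t i j * f j) + m ^+ 2 * p t i j)
      = p t i j * (f j - m) ^+ 2 by ring.
  have ge0 j : 0 <= p t i j * f j ^+ 2 +
     (- (2 * m) * (p t i j * f j) + m ^+ 2 * p t i j).
    by rewrite e mulr_ge0 ?p_ge0 ?sqr_ge0.
  exact: csum_ge0.
rewrite csumD//; last by apply: abs_summableD; exact: abs_summableZ.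
rewrite csumD; try exact: abs_summableZ.
rewrite !csumZ// -/(semigroup p t f i) -/m.
have := sqr_ge0 m; nra.
Qed.

(** Jensen's inequality is summed against [mu]; after Tonelli, symmetry turns the inner sum into a
    row sum of [p], which is at most 1. *)
Let semigroup_square_le t f : 0 <= t -> L2 mu f ->
  (\esum_(i in [set: E]) (mu i * semigroup p t f i ^+ 2)%:E <=
   \esum_(i in [set: E]) (mu i * f i ^+ 2)%:E)%E.
Proof.
move=> t0 f2; apply: (@le_trans _ _ (\esum_(i in [set: E])
    \esum_(j in [set: E]) ((mu i * p t i j) * f j ^+ 2)%:E)).
  apply: le_esum => i _; under eq_esum do rewrite -mulrA EFinM.
  rewrite ge0_esumZl//; last by move=> j; rewrite lee_fin mulr_ge0 ?p_ge0 ?sqr_ge0.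
  by rewrite EFinM lee_wpmul2l ?semigroup_Jensen// lee_fin.
rewrite esum_exchange; last first.
  by move=> i j; rewrite lee_fin mulr_ge0 ?sqr_ge0// mulr_ge0 ?p_ge0.
apply: le_esum => j _.
under eq_esum do rewrite p_symmetric// mulrAC EFinM.
have mf0 : 0 <= mu j * f j ^+ 2 by rewrite mulr_ge0 ?sqr_ge0.
rewrite ge0_esumZl//; last by move=> i; rewrite lee_fin p_ge0.
by rewrite -[leRHS]mule1 lee_wpmul2l ?transition_le1// lee_fin.
Qed.

Lemma L2_semigroup t f : 0 <= t -> L2 mu f -> L2 mu (semigroup p t f).
Proof. by move=> t0 f2; apply: le_lt_trans (semigroup_square_le t0 f2) _. Qed.

Lemma semigroup_contraction t f : 0 <= t -> L2 mu f ->
  inner mu (semigroup p t f) (semigroup p t f) <= inner mu f f.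
Proof.
move=> t0 f2; have fin h : L2 mu h ->
    \esum_(i in [set: E]) (mu i * h i ^+ 2)%:E \is a fin_num.
  by rewrite ge0_fin_numE// esum_ge0// => i _; rewrite lee_fin mulr_ge0// sqr_ge0.
rewrite !inner_normE// fine_le ?fin//; first exact: L2_semigroup.
exact: semigroup_square_le.
Qed.

Lemma inner_semigroup_esum t u v : 0 <= t ->
  (forall i, 0 <= u i) -> (forall i, 0 <= v i) -> L2 mu u -> L2 mu v ->
  (inner mu (semigroup p t u) v)%:E = (\esum_(i in [set: E])
    \esum_(j in [set: E]) (mu i * p t i j * u j * v i)%:E)%E.
Proof.
move=> t0 u0 v0 u2 v2; rewrite inner_esum//;
  [|by move=> i; exact: semigroup_ge0|exact: L2_semigroup].
apply: eq_esum => i _.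
rewrite mulrAC EFinM semigroup_ge0E// -ge0_esumZl ?mulr_ge0//.
  by apply: eq_esum => j _; rewrite -EFinM; congr _%:E; ring.
by move=> j; rewrite lee_fin mulr_ge0 ?p_ge0.
Qed.

(** Both sides equal one nonnegative triple sum: Chapman-Kolmogorov expands the left side, Tonelli
    reorders it, and symmetry moves the factor at time [t] onto [v]. *)
Let inner_semigroup_ge0 s t u v : 0 <= s -> 0 <= t ->
  (forall i, 0 <= u i) -> (forall i, 0 <= v i) -> L2 mu u -> L2 mu v ->
  inner mu (semigroup p (s + t) u) v =
  inner mu (semigroup p s u) (semigroup p t v).
Proof.
move=> s0 t0 u0 v0 u2 v2; have st0 : 0 <= s + t by rewrite addr_ge0.
apply: EFin_inj; rewrite inner_semigroup_esum// inner_esum//;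
  try (by move=> i; exact: semigroup_ge0); try exact: L2_semigroup.
transitivity (\esum_(i in [set: E]) \esum_(j in [set: E])
    \esum_(k in [set: E]) (mu i * p t i k * p s k j * u j * v i)%:E)%E.
  apply: eq_esum => i _; apply: eq_esum => j _.
  (* Taking the time-[t] step first leaves [p t i k] next to [mu i], where symmetry can act. *)
  rewrite addrC (_ : mu i * _ * _ * _ = mu i * u j * v i * p (t + s) i j); last by ring.
  rewrite EFinM chapman_kolmogorov// -ge0_esumZl ?mulr_ge0//; last first.
    by move=> k; rewrite lee_fin mulr_ge0 ?p_ge0.
  by apply: eq_esum => k _; rewrite -EFinM; congr _%:E; ring.
have nng i j k : (0 <= (mu i * p t i k * p s k j * u j * v i)%:E)%E.
  by rewrite lee_fin !mulr_ge0 ?p_ge0.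
transitivity (\esum_(i in [set: E]) \esum_(k in [set: E]) \esum_(j in [set: E])
    (mu i * p t i k * p s k j * u j * v i)%:E)%E.
  by apply: eq_esum => i _; rewrite esum_exchange.
rewrite esum_exchange; last by move=> i k; apply: esum_ge0.
apply: eq_esum => k _; rewrite EFinM [in RHS](semigroup_ge0E k t0)//.
rewrite -ge0_esumZl ?mulr_ge0 ?semigroup_ge0//; last first.
  by move=> i; rewrite lee_fin mulr_ge0 ?p_ge0.
apply: eq_esum => i _; rewrite p_symmetric//.
rewrite -EFinM (_ : _ * (p t k i * v i) =
  mu k * p t k i * v i * semigroup p s u k); last by ring.
rewrite EFinM semigroup_ge0E// -ge0_esumZl ?mulr_ge0 ?p_ge0//.
  by apply: eq_esum => j _; rewrite -EFinM; congr _%:E; ring.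
by move=> j; rewrite lee_fin mulr_ge0 ?p_ge0.
Qed.

(** The difference is written with a factor -1 so that additivity and homogeneity suffice to expand
    it. *)
Let pos_neg f : f = (fun i => f^\+ i + -1 * f^\- i).
Proof.
apply/funext => i; rewrite /funrpos /funrneg.
by case: (leP (f i) 0); case: (leP (- f i) 0); lra.
Qed.

Let L2_pos f : L2 mu f -> L2 mu f^\+.
Proof.
apply: L2_le => // i; rewrite ger0_norm// /funrpos ge_max normr_ge0.
by rewrite ler_norm.
Qed.

Let L2_neg f : L2 mu f -> L2 mu f^\-.
Proof.
apply: L2_le => // i; rewrite ger0_norm// /funrneg ge_max normr_ge0.
by rewrite -normrN ler_norm.
Qed.

Lemma inner_semigroup s t f g : 0 <= s -> 0 <= t -> L2 mu f -> L2 mu g ->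
  inner mu (semigroup p (s + t) f) g =
  inner mu (semigroup p s f) (semigroup p t g).
Proof.
move=> s0 t0 f2 g2; have st0 : 0 <= s + t by rewrite addr_ge0.
have fp := L2_pos f2; have fn := L2_neg f2.
have gp := L2_pos g2; have gn := L2_neg g2.
have S r h : 0 <= r -> L2 mu h -> L2 mu (semigroup p r h) by exact: L2_semigroup.
have Z c h : L2 mu h -> L2 mu (fun i => c * h i) by exact: L2Z.
have D h k : L2 mu h -> L2 mu k -> L2 mu (fun i => h i + k i) by exact: L2D.
rewrite (pos_neg f) (pos_neg g).
rewrite !semigroupD ?semigroupZ//; do ?exact: Z.
(* Bilinearity reduces the identity to four pairs of nonnegative functions. *)
rewrite !innerDl ?innerDr ?innerZl ?innerZr//; do ?by auto.
have B u v := @inner_semigroup_ge0 s t u v s0 t0.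
rewrite (B _ _ (funrpos_ge0 f) (funrpos_ge0 g))// (B _ _ (funrpos_ge0 f) (funrneg_ge0 g))//.
by rewrite (B _ _ (funrneg_ge0 f) (funrpos_ge0 g))// (B _ _ (funrneg_ge0 f) (funrneg_ge0 g)).
Qed.

End SymmetricSemigroup.

(** * Sums of finitely supported families *)

Section FiniteSupport.
Context {R : realType} {E : countType}.

Lemma esum_finite_support (F : set E) (a : E -> R) : finite_set F ->
  (forall i, 0 <= a i) -> (forall i, ~ F i -> a i = 0) ->
  (\esum_(i in [set: E]) (a i)%:E)%E = (\sum_(i <- fset_set F) a i)%:E.
Proof.
move=> finF a0 aF; transitivity (\esum_(i in F) (a i)%:E)%E.
  rewrite [RHS]esum_mkcond; apply: eq_esum => i _.
  by case: ifPn => //; rewrite notin_setE => /aF ->.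
by rewrite esum_fset// ?fsbig_finite// ?sumEFin// => i _; rewrite lee_fin.
Qed.

Lemma csum_single_support i (a : E -> R) : (forall j, j != i -> a j = 0) ->
  csum a = a i.
Proof.
have single (b : E -> R) : (forall j, 0 <= b j) -> (forall j, j != i -> b j = 0) ->
    (\esum_(j in [set: E]) (b j)%:E)%E = (b i)%:E.
  move=> b0 bi; rewrite (@esum_finite_support [set i])//.
    by rewrite fset_set1 big_seq_fset1.
  by move=> j /eqP; exact: bi.
move=> ai; rewrite /csum !single//.
- by rewrite -EFinB /= /funrpos /funrneg; case: (leP (a i) 0); case: (leP (- a i) 0); lra.
- by move=> j /ai; rewrite /funrneg => ->; rewrite oppr0 maxxx.
- by move=> j /ai; rewrite /funrpos => ->; rewrite maxxx.
Qed.

End FiniteSupport.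

(** * The Dirichlet form *)

Section DirichletForm.
Context {R : realType} {E : countType} (p : R -> E -> E -> R) (mu : E -> R).
Hypothesis p_standard : standard_transition p.
Hypothesis mu_gt0 : forall i, 0 < mu i.
Hypothesis p_symmetric : symmetric_wrt mu p.
Implicit Types (f g u v : E -> R) (s t : R).

Let mu_ge0 i : 0 <= mu i. Proof. exact: ltW. Qed.
Let p_ge0 t i j : 0 <= t -> 0 <= p t i j.
Proof. exact: transition_ge0. Qed.

Local Notation phi f t := (inner mu (semigroup p t f) f).

Lemma semigroup0 f : semigroup p 0 f = f.
Proof.
apply/funext => i; rewrite /semigroup (@csum_single_support _ _ i).
  by rewrite transition_id// eqxx mul1r.
by move=> j ji; rewrite transition_id// eq_sym (negPf ji) mul0r.
Qed.

(** For [g = f] the right side is a squared norm, whence the nonnegativity of [phi f] and its bound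
    by the contraction property. *)
Lemma inner_semigroup_half t f g : 0 <= t -> L2 mu f -> L2 mu g ->
  inner mu (semigroup p t f) g =
  inner mu (semigroup p (t / 2) f) (semigroup p (t / 2) g).
Proof.
move=> t0 f2 g2; rewrite -(inner_semigroup p_standard) ?divr_ge0//.
by congr (inner mu (semigroup p _ f) g); field.
Qed.

Lemma quadratic_form_ge0 f t : L2 mu f -> 0 <= t -> 0 <= phi f t.
Proof. by move=> f2 t0; rewrite inner_semigroup_half// inner_ge0. Qed.

Lemma quadratic_form_logconvex f s t : L2 mu f -> 0 <= s -> 0 <= t ->
  phi f (s + t) ^+ 2 <= phi f (s + s) * phi f (t + t).
Proof.
move=> f2 s0 t0; have split a b (a0 : 0 <= a) (b0 : 0 <= b) :=
  inner_semigroup p_standard mu_gt0 p_symmetric a0 b0 f2 f2.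
rewrite (split s t)// (split s s)// (split t t)//.
by apply: inner_CauchySchwarz; first exact: mu_gt0;
  exact: (L2_semigroup p_standard).
Qed.

Lemma quadratic_form_le f t : L2 mu f -> 0 <= t -> phi f t <= inner mu f f.
Proof.
move=> f2 t0; rewrite inner_semigroup_half//.
by apply: (semigroup_contraction p_standard) => //; rewrite divr_ge0.
Qed.

Lemma quadratic_form_quotient f t : L2 mu f -> 0 < t ->
  t^-1 * inner mu (f \- semigroup p t f) f = (inner mu f f - phi f t) / t.
Proof.
move=> f2 t0; have Pf2 := L2_semigroup p_standard mu_gt0 p_symmetric (ltW t0) f2.
rewrite mulrC; congr (_ / t).
have -> : f \- semigroup p t f = (fun i => f i + -1 * semigroup p t f i).
  by apply/funext => i /=; rewrite mulN1r.
by rewrite innerDl ?innerZl ?mulN1r//; exact: L2Z.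
Qed.

Lemma quadratic_form_quotient_nonincreasing f s t : L2 mu f -> 0 < s -> s <= t ->
  (inner mu f f - phi f t) / t <= (inner mu f f - phi f s) / s.
Proof.
move=> f2; have := @logconvex_bounded_slope R (fun t => phi f t)
  (fun t => quadratic_form_ge0 f2) (fun s t => quadratic_form_logconvex f2)
  (inner mu f f) (fun t => quadratic_form_le f2) s t.
by rewrite semigroup0.
Qed.

(** The difference quotient is nonincreasing in [t], so its right limit at 0 exists in the extended
    reals and is a supremum; the value may be infinite. *)
Lemma dirichletE f : L2 mu f -> dirichlet mu p f =
  ereal_sup [set ((inner mu f f - phi f t) / t)%:E | t in `]0, +oo[].
Proof.
move=> f2; apply/cvg_lim => //.
have -> : [set ((inner mu f f - phi f t) / t)%:E | t in `]0, +oo[] =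
    [set (t^-1 * inner mu (f \- semigroup p t f) f)%:E | t in `]0, +oo[].
  apply: eq_imagel => t /=; rewrite in_itv/= andbT => t0.
  by rewrite quadratic_form_quotient.
apply: (@nonincreasing_at_right_cvge _ _ 0 (BInfty _ false)) => // s t.
rewrite !in_itv/= !andbT => s0 t0 st.
by rewrite lee_fin !quadratic_form_quotient// quadratic_form_quotient_nonincreasing.
Qed.

(** Some quotient exceeds [l], and by monotonicity so do all quotients at smaller times. *)
Lemma near_le_of_lt_dirichlet f (l : R) : L2 mu f -> (l%:E < dirichlet mu p f)%E ->
  \forall h \near 0^'+, phi f h <= inner mu f f - l * h.
Proof.
move=> f2; rewrite dirichletE// => /ereal_sup_gt[_ [t /= t0 <-]].
move: t0; rewrite in_itv/= andbT lte_fin => t0 lt.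
near=> h; have h0 : 0 < h by near: h; exact: nbhs_right_gt.
have ht : h <= t by near: h; exact: nbhs_right_le.
have := quadratic_form_quotient_nonincreasing f2 h0 ht.
move=> /(lt_le_trans lt)/ltW; rewrite ler_pdivlMr//; lra.
Unshelve. all: by end_near. Qed.

Lemma dirichlet_ge_of_decay f (a : R) : L2 mu f ->
  (forall t, 0 < t -> phi f t <= expR (- a * t) * inner mu f f) ->
  ((a * inner mu f f)%:E <= dirichlet mu p f)%E.
Proof.
move=> f2 decay; have A0 := inner_ge0 mu_gt0 f.
set A := inner mu f f in decay A0 *.
have quot t : 0 < t -> (((A - phi f t) / t)%:E <= dirichlet mu p f)%E.
  move=> t0; rewrite dirichletE//; apply: ereal_sup_ubound; exists t => //=.
  by rewrite in_itv/= andbT.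
(* For [a <= 0] the left side is nonpositive, while every quotient is nonnegative. *)
have [a0|a0] := leP a 0.
  apply: le_trans (quot 1 ltr01); rewrite lee_fin divr1.
  rewrite (@le_trans _ _ 0)// ?mulr_le0_ge0// subr_ge0.
  exact: quadratic_form_le.
apply/lee_addgt0Pr => e e0.
(* Small enough that the second-order error [a^2 A t] is at most [e]; the added 1 keeps the
   denominator positive. *)
pose t := e / (a ^+ 2 * A + 1).
have d0 : 0 < a ^+ 2 * A + 1 by rewrite ltr_wpDl// mulr_ge0// sqr_ge0.
have t0 : 0 < t by rewrite divr_gt0.
rewrite -leeBlDr//; apply: le_trans (quot t t0).
rewrite -EFinB lee_fin ler_pdivlMr//.
(* For [x > 0], [exp(-x) <= 1 / (1 + x) <= 1 - x + x^2], because
   [(1 + x)(1 - x + x^2) = 1 + x^3]. *)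
have exp_le : expR (- a * t) <= 1 - a * t + (a * t) ^+ 2.
  have at0 : 0 < a * t by rewrite mulr_gt0.
  have := expR_ge1Dx (a * t); have := expR_gt0 (- a * t).
  have : expR (- a * t) * expR (a * t) = 1 by rewrite mulNr -expRD addNr expR0.
  set x := expR _; set y := expR _; nra.
have te : t * (a ^+ 2 * A) <= e.
  by rewrite mulrAC ler_pdivrMr// ler_pM2l// lerDl.
have := decay t t0; have : expR (- a * t) * A <= (1 - a * t + (a * t) ^+ 2) * A.
  by rewrite ler_wpM2r.
have : t * (a ^+ 2 * A) * t <= e * t by rewrite ler_pM2r.
nra.
Qed.

End DirichletForm.

(** * Decay rates *)

Section DecayRate.
Context {R : realType} {E : countType} (p : R -> E -> E -> R) (mu : E -> R).
Hypothesis p_standard : standard_transition p.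
Hypothesis mu_gt0 : forall i, 0 < mu i.
Hypothesis p_symmetric : symmetric_wrt mu p.
Implicit Types (f g u v : E -> R) (s t : R).

Let mu_ge0 i : 0 <= mu i. Proof. exact: ltW. Qed.
Let p_ge0 t i j : 0 <= t -> 0 <= p t i j.
Proof. exact: transition_ge0. Qed.

Local Notation phi f t := (inner mu (semigroup p t f) f).

Let e (i : E) : E -> R := fun j => (j == i)%:R.

Let L2_e i : L2 mu (e i).
Proof.
rewrite /L2/= (@esum_finite_support _ _ [set i]) ?ltry//.
  by move=> j; rewrite mulr_ge0// sqr_ge0.
by move=> j /eqP/negPf ji; rewrite /e ji expr0n mulr0.
Qed.

Let inner_e f i : inner mu f (e i) = mu i * f i.
Proof.
rewrite /inner (@csum_single_support _ _ i) /e ?eqxx ?mulr1//.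
by move=> j /negPf ->; rewrite mulr0.
Qed.

Let semigroup_e t i : semigroup p t (e i) = (fun j => p t j i).
Proof.
apply/funext => j; rewrite /semigroup (@csum_single_support _ _ i) /e ?eqxx ?mulr1//.
by move=> k /negPf ->; rewrite mulr0.
Qed.

Let semigroup_semigroup_e s t i : 0 <= s -> 0 <= t ->
  semigroup p s (semigroup p t (e i)) = semigroup p (s + t) (e i).
Proof.
move=> s0 t0; rewrite !semigroup_e; apply/funext => j.
rewrite /semigroup csum_ge0E; last by move=> k; rewrite mulr_ge0 ?p_ge0.
by rewrite -chapman_kolmogorov.
Qed.

(** * From the Dirichlet form to decay of the transition probabilities *)

Lemma return_probability_decay (l : R) i T : (l%:E < lambda0 mu p)%E -> 0 < T ->
  p T i i <= expR (- l * T).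
Proof.
move=> ll0 T0; have phi_e t : phi (e i) t = mu i * p t i i.
  by rewrite inner_e semigroup_e.
suff : phi (e i) T <= expR (- l * T) * phi (e i) 0.
  by rewrite !phi_e transition_id// eqxx mulr1 mulrC ler_pM2r.
apply: (@logconvex_decay_backward _ (fun t => phi (e i) t)) => //.
- by move=> t; exact: (quadratic_form_ge0 p_standard).
- by move=> s t; exact: (quadratic_form_logconvex p_standard).
have half0 : 0 <= T / 2 by rewrite divr_ge0// ltW.
(* Shifting time by [T]: [phi g h] is [phi (e i) (T + h)], and the squared norm of [g] is
   [phi (e i) T]. *)
pose g := semigroup p (T / 2) (e i).
have g2 : L2 mu g by exact: (L2_semigroup p_standard).
have gg h : 0 <= h -> phi g h = phi (e i) (T + h).
  move=> h0; rewrite /g semigroup_semigroup_e//.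
  have hT0 : 0 <= h + T / 2 by rewrite addr_ge0.
  have -> : T + h = h + T / 2 + T / 2 by field.
  exact/esym/(inner_semigroup p_standard mu_gt0 p_symmetric hT0 half0).
have gT : inner mu g g = phi (e i) T.
  by rewrite -{1}(semigroup0 p_standard g) gg// addr0.
have A0 := inner_ge0 mu_gt0 g.
(* If [g] has norm zero it cannot be normalised, but then [phi g] vanishes and the bound is
   immediate. *)
have [Aeq0|Ane0] := eqVneq (inner mu g g) 0.
  near=> h; have h0 : 0 <= h by apply: ltW; near: h; exact: nbhs_right_gt.
  rewrite -gg// -gT Aeq0 mulr0 -[leRHS]Aeq0.
  exact: (quadratic_form_le p_standard).
have Agt0 : 0 < inner mu g g by rewrite lt_def Ane0.
pose c := (Num.sqrt (inner mu g g))^-1.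
pose f j := c * g j.
have f2 : L2 mu f by exact: L2Z.
have c2 : c ^+ 2 = (inner mu g g)^-1 by rewrite exprVn sqr_sqrtr.
have ff h : 0 <= h -> phi f h = c ^+ 2 * phi g h.
  move=> h0; rewrite /f (semigroupZ p_standard mu_gt0 p_symmetric)//.
  have Pg2 : L2 mu (semigroup p h g) by exact: (L2_semigroup p_standard).
  by rewrite innerZl ?innerZr// ?mulrA//; exact: L2Z.
have f1 : inner mu f f = 1.
  have := ff 0 (lexx 0); rewrite !semigroup0// => ->.
  by rewrite c2 mulVf.
have lf : (l%:E < dirichlet mu p f)%E.
  (* [lambda0] only sees functions of finite Dirichlet form; for the others the strict inequality is
     trivial. *)
  have [foo|] := ltP (dirichlet mu p f) +oo%E; last first.
    by rewrite leye_eq => /eqP ->; rewrite ltry.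
  apply: (lt_le_trans ll0); apply: ereal_inf_lbound; exists f => //.
  by split=> //; rewrite /L2norm f1 sqrtr1.
have := near_le_of_lt_dirichlet p_standard mu_gt0 p_symmetric f2 lf.
apply: filterS2 (nbhs_right_gt (0 : R)) => h h0.
rewrite (ff _ (ltW h0)) f1 c2 mulrC ler_pdivrMr// (gg _ (ltW h0)) gT => /le_trans; apply.
(* The linear bound is weakened to an exponential one by [1 - l h <= exp(-l h)]. *)
rewrite ler_wpM2r ?(le_trans A0) -?gT//.
by rewrite (le_trans _ (expR_ge1Dx _))// mulNr.
Unshelve. all: by end_near. Qed.

(** Cauchy-Schwarz at time [t / 2] bounds the square of the left side by the product of the two
    diagonal terms. The sum [mu i + mu j] replaces the geometric mean to avoid a square root. *)
Lemma transition_bound (l : R) i j t : (l%:E < lambda0 mu p)%E -> 0 < t ->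
  mu i * p t i j <= expR (- l * t) * (mu i + mu j).
Proof.
move=> ll0 t0; have t0' := ltW t0.
have mp0 : 0 <= mu i * p t i j by rewrite mulr_ge0 ?p_ge0.
have rhs0 : 0 <= expR (- l * t) * (mu i + mu j).
  by rewrite mulr_ge0 ?expR_ge0 ?addr_ge0.
rewrite -(ler_pXn2r (ltn0Sn 1)) ?nnegrE//.
have -> : mu i * p t i j = inner mu (semigroup p t (e j)) (e i).
  by rewrite inner_e semigroup_e.
rewrite (inner_semigroup_half p_standard)//.
have half0 : 0 <= t / 2 by rewrite divr_ge0.
have P2 k : L2 mu (semigroup p (t / 2) (e k)) by exact: (L2_semigroup p_standard).
apply: le_trans (inner_CauchySchwarz mu_gt0 (P2 j) (P2 i)) _.
have half k := inner_semigroup_half p_standard mu_gt0 p_symmetric t0' (L2_e k) (L2_e k).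
rewrite -(half j) -(half i) !inner_e !semigroup_e.
have pl k : mu k * p t k k <= mu k * expR (- l * t).
  by rewrite ler_pM2l// return_probability_decay.
have q0 k : 0 <= mu k * p t k k by rewrite mulr_ge0 ?p_ge0.
apply: le_trans (ler_pM (q0 j) (q0 i) (pl j) (pl i)) _.
have := mu_ge0 i; have := mu_ge0 j; have := expR_ge0 (- l * t).
set x := expR _ => x0 j0 i0.
have -> : mu j * x * (mu i * x) = x ^+ 2 * (mu i * mu j) by ring.
rewrite exprMn ler_wpM2l ?sqr_ge0//; nra.
Qed.

Lemma lambda0_le_alpha_star : (lambda0 mu p <= alpha_star p)%E.
Proof.
have alpha_ge (l : R) : (l%:E < lambda0 mu p)%E -> (l%:E <= alpha_star p)%E.
  move=> ll0; apply: ereal_sup_ubound; exists l => // i j.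
  apply/eqO_exP; exists ((mu i)^-1 * (mu i + mu j)).
    by rewrite mulr_gt0 ?invr_gt0 ?addr_gt0.
  near=> t; have t0 : 0 < t by near: t; exact: nbhs_pinfty_gt.
  have bnd : p t i j <= (mu i)^-1 * (mu i + mu j) * expR (- l * t).
    rewrite -(ler_pM2l (mu_gt0 i)) (le_trans (transition_bound i j ll0 t0))//.
    rewrite le_eqVlt; apply/orP; left; apply/eqP.
    by field; rewrite gt_eqF.
  by rewrite (ger0_norm (expR_ge0 _)) (ger0_norm (p_ge0 i j (ltW t0))).
(* Every real below [lambda0] is an admissible rate; a finite [lambda0] is approached from below, an
   infinite one by all reals. *)
case: (lambda0 mu p) alpha_ge => [l| |] alpha_ge; last by rewrite leNye.
  apply/lee_addgt0Pr => d d0; rewrite -leeBlDr// -EFinB alpha_ge//.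
  by rewrite lte_fin ltrBlDr ltrDl.
by rewrite leye_eq; apply/eqP/eq_infty => l; rewrite alpha_ge// ltry.
Unshelve. all: by end_near. Qed.

(** * From decay of the transition probabilities to the Dirichlet form *)

Let eventually_le_exp (a : R) (h : R -> R) :=
  exists C : R, \forall t \near +oo, h t <= C * expR (- a * t).

Let eventually_le_exp_sum (a : R) (I : Type) (r : seq I) (h : I -> R -> R) :
  (forall i, eventually_le_exp a (h i)) ->
  eventually_le_exp a (fun t => \sum_(i <- r) h i t).
Proof.
move=> hO; elim: r => [|i r [C IH]].
  by exists 0; near=> t; rewrite big_nil mul0r.
have [D hD] := hO i; exists (D + C); near=> t; rewrite big_cons mulrDl lerD//.
  by near: t.
by near: t.
Unshelve. all: by end_near. Qed.

Lemma finite_support_decay (a : R) (F : set E) u t : finite_set F ->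
  (forall i j, (fun t => p t i j) =O_ +oo (fun t => expR (- a * t))) ->
  (forall i, 0 <= u i) -> (forall i, ~ F i -> u i = 0) -> L2 mu u -> 0 <= t ->
  phi u t <= expR (- a * t) * inner mu u u.
Proof.
move=> finF pO u0 uF u2 t0.
have phiE s : 0 <= s -> phi u s = \sum_(i <- fset_set F) \sum_(j <- fset_set F)
    mu i * p s i j * u j * u i.
  move=> s0; apply: EFin_inj; rewrite (inner_semigroup_esum p_standard)//.
  have -> : (\esum_(i in [set: E]) \esum_(j in [set: E])
       (mu i * p s i j * u j * u i)%:E =
     \esum_(i in [set: E])
       (\sum_(j <- fset_set F) mu i * p s i j * u j * u i)%:E)%E.
    apply: eq_esum => i _; rewrite (esum_finite_support finF)//.
      by move=> j; rewrite !mulr_ge0 ?p_ge0.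
    by move=> j /uF ->; rewrite mulr0 mul0r.
  rewrite (esum_finite_support finF)//.
    by move=> i; rewrite sumr_ge0// => j _; rewrite !mulr_ge0 ?p_ge0.
  by move=> i /uF ui; rewrite big1// => j _; rewrite ui mulr0.
(* A finite combination of the [p s i j] with nonnegative coefficients keeps the rate [a]; its
   constant is then removed by log-convexity. *)
have [C HC] : eventually_le_exp a (fun s => phi u s).
  have [C HC] : eventually_le_exp a (fun s => \sum_(i <- fset_set F)
      \sum_(j <- fset_set F) mu i * p s i j * u j * u i).
    apply: eventually_le_exp_sum => i; apply: eventually_le_exp_sum => j.
    have /eqO_exP[C C0 HC] := pO i j.
    exists (mu i * u j * u i * C); near=> s.
    rewrite (_ : _ * u i = mu i * u j * u i * p s i j); last by ring.
    rewrite -[leRHS]mulrA ler_wpM2l ?mulr_ge0//.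
    have := near HC s; rewrite /= (ger0_norm (expR_ge0 _)).
    by move=> H; rewrite (le_trans (ler_norm _))// H.
  exists C; near=> s; have s0 : 0 < s by near: s; exact: nbhs_pinfty_gt.
  by rewrite phiE ?(ltW s0)//; near: s.
have -> : inner mu u u = phi u 0 by rewrite semigroup0.
exact: (@logconvex_decay_forward _ (fun s => phi u s)
  (fun s => quadratic_form_ge0 p_standard mu_gt0 p_symmetric u2)
  (fun r s => quadratic_form_logconvex p_standard mu_gt0 p_symmetric u2)
  C a t t0 HC).
Unshelve. all: by end_near. Qed.

Lemma nonneg_decay (a : R) u t :
  (forall i j, (fun t => p t i j) =O_ +oo (fun t => expR (- a * t))) ->
  (forall i, 0 <= u i) -> L2 mu u -> 0 <= t ->
  phi u t <= expR (- a * t) * inner mu u u.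
Proof.
move=> pO u0 u2 t0; rewrite -lee_fin (inner_semigroup_esum p_standard)//.
have b0 i j v : (forall k, 0 <= v k) -> (0 <= (mu i * p t i j * v j * v i)%:E)%E.
  by move=> v0; rewrite lee_fin !mulr_ge0 ?p_ge0.
have rhs0 : 0 <= expR (- a * t) * inner mu u u.
  by rewrite mulr_ge0 ?expR_ge0 ?inner_ge0.
rewrite esum_esum; last by move=> i j _ _; exact: b0.
apply: ge_ereal_sup => _ [X [finX _] <-].
(* [F] contains every index occurring in the finite set of pairs [X], so truncating [u] to [F]
   leaves the subsum over [X] unchanged. *)
pose F := X.`1 `|` X.`2.
have finF : finite_set F.
  by rewrite finite_setU; split; [exact: finite_set_fst|exact: finite_set_snd].
pose v := u \_ F.
have v0 i : 0 <= v i by exact: restrict_ge0.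
have vu i : `|v i| <= `|u i|.
  by rewrite /v /patch; case: ifP => // _; rewrite normr0.
have v2 : L2 mu v by exact: L2_le u2.
have -> : (\sum_(k \in X) (mu k.1 * p t k.1 k.2 * u k.2 * u k.1)%:E =
    \sum_(k \in X) (mu k.1 * p t k.1 k.2 * v k.2 * v k.1)%:E)%E.
  apply: eq_fsbigr => -[i j]; rewrite inE => Xij /=.
  have Fi : F i by left; exists j.
  have Fj : F j by right; exists i.
  by rewrite /v /patch !mem_set.
(* The subsum is at most [phi v t], which decays by the finite case, and truncation does not
   increase the norm. *)
apply: (@le_trans _ _ (phi v t)%:E); last first.
  rewrite lee_fin (@le_trans _ _ (expR (- a * t) * inner mu v v))//.
    apply: (finite_support_decay finF) => // i Fi.
    by rewrite /v /patch memNset.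
  by rewrite ler_wpM2l ?expR_ge0// inner_le.
rewrite (inner_semigroup_esum p_standard)//.
rewrite esum_esum; last by move=> i j _ _; exact: b0.
apply: ereal_sup_ubound; exists X => //; split=> // k _; split.
Qed.

Lemma quadratic_form_decay (a : R) f t :
  (forall i j, (fun t => p t i j) =O_ +oo (fun t => expR (- a * t))) ->
  L2 mu f -> 0 <= t -> phi f t <= expR (- a * t) * inner mu f f.
Proof.
move=> pO f2 t0; pose u i := `|f i|.
have u2 : L2 mu u by apply: L2_le f2 => // i; rewrite normr_id.
have uu : inner mu u u = inner mu f f.
  by congr csum; apply/funext => i; rewrite -mulrA -expr2 real_normK ?num_real// expr2 mulrA.
rewrite -uu; apply: le_trans (nonneg_decay pO _ u2 t0); last by move=> i; exact: normr_ge0.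
have Pf2 := L2_semigroup p_standard mu_gt0 p_symmetric t0 f2.
have Pu2 := L2_semigroup p_standard mu_gt0 p_symmetric t0 u2.
(* Positivity of the semigroup gives [|P_t f| <= P_t |f|], hence [phi f t <= phi u t], while [f] and
   [u] have the same norm. *)
have Pfu i : `|semigroup p t f i| <= semigroup p t u i.
  have sf := semigroup_summable p_standard mu_gt0 p_symmetric i t0 f2.
  have su := semigroup_summable p_standard mu_gt0 p_symmetric i t0 u2.
  rewrite ler_norml -mulN1r -csumZ//; apply/andP; split; apply: le_csum => //.
  - exact: abs_summableZ.
  - by move=> j; rewrite mulrCA mulN1r ler_wpM2l ?p_ge0// /u lerNl -normrN ler_norm.
  - by move=> j; rewrite ler_wpM2l ?p_ge0// /u ler_norm.
apply: le_csum; [exact: inner_summable|exact: inner_summable|move=> i].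
by rewrite -!mulrA ler_pM2l// (le_trans (ler_norm _))// normrM ler_wpM2r.
Qed.

Lemma alpha_star_le_lambda0 : (alpha_star p <= lambda0 mu p)%E.
Proof.
apply: ge_ereal_sup => _ [a pO <-]; apply: le_ereal_inf_tmp => _ [f [[f2 _] f1] <-].
have ff : inner mu f f = 1.
  by rewrite -[LHS]sqr_sqrtr ?inner_ge0// -/(L2norm mu f) f1 expr1n.
rewrite -[a]mulr1 -ff; apply: (dirichlet_ge_of_decay p_standard) => // t t0.
by apply: quadratic_form_decay; rewrite ?ltW.
Qed.

End DecayRate.

Theorem proposition1p2 (R : realType) (E : countType)
    (p : R -> E -> E -> R) (mu : E -> R)
    (p_standard : standard_transition p)
    (mu_gt0 : forall i, 0 < mu i)
    (p_symmetric : symmetric_wrt mu p)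
    (p_non_ergodic : non_ergodic p) :
  alpha_star p = lambda0 mu p.
Proof.
apply/eqP; rewrite eq_le alpha_star_le_lambda0//=.
exact: (lambda0_le_alpha_star p_standard).
Qed.
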